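(* Every finite poset $(P,>)$ has a cut $(B,U)$ with $$e(B,U)\ \ge\ \frac{e(P,P)}{2}.$$ The bound is tight up to lower-order terms: there is a sequence of finite posets $P_n$ with $e(P_n,P_n)\to\infty$ such that $\max_{(B,U)} e(B,U) = \frac{1+o_n(1)}{2}\, e(P_n,P_n)$ as $n\to\infty$, where the maximum is over all cuts $(B,U)$ of $P_n$. Moreover, there is an algorithm that, given a finite poset $(P,>)$, finds a cut $(B,U)$ with $e(B,U)\ge e(P,P)/2$ in time $O(|(P,>)|)$.
   Context: $(P,>)$ is a finite partially ordered set with strict order relation. For subsets $X,Y\subseteq P$ (not necessarily disjoint), $E(X,Y):=\{(x,y) : x\in X,\ y\in Y,\ x<y\}$ and $e(X,Y):=|E(X,Y)|$; in particular $e(P,P)$ is the number of pairs $(x,y)$ with $x<y$ in $P$. A cut in $(P,>)$ is an ordered partition $(B,U)$ of the set $P$, i.e. $B\cup U=P$ and $B\cap U=\emptyset$ (a part may be empty); its size is $e(B,U)$. $|(P,>)|$ denotes the size of the input poset, given as the list of its elements together with the list of all pairs $x<y$, i.e. $|P|+e(P,P)$; running time is counted in elementary operations in the standard unit-cost RAM model. *)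

(* Defs.v *)
From HB Require Import structures.
From mathcomp Require Import all_boot all_order all_algebra.

Set Implicit Arguments.
Unset Strict Implicit.
Unset Printing Implicit Defensive.

Import Order.TTheory GRing.Theory Num.Theory.

Section Cuts.
Context {d : Order.disp_t} {T : finPOrderType d}.
Implicit Types X Y B U : {set T}.

(* E(X, Y) *)
Definition lt_pairs X Y : {set T * T} :=
  [set p | [&& p.1 \in X, p.2 \in Y & (p.1 < p.2)%O]].

(* e(X, Y) *)
Definition num_pairs X Y : nat := #|lt_pairs X Y|.

Definition is_cut B U : bool := (B :|: U == setT) && (B :&: U == set0).

End Cuts.

Section PosetParameters.
Context {d : Order.disp_t} (T : finPOrderType d).

(* e(P, P) *)
Definition num_all_pairs : nat := num_pairs [set: T] [set: T].

Definition poset_size : nat := #|T| + num_all_pairs.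

Definition max_cut : nat :=
  \max_(c : {set T} * {set T} | is_cut c.1 c.2) num_pairs c.1 c.2.

End PosetParameters.

(* The unit-cost random access machine of Cook and Reckhow ("Time bounded
   random access machines", 1973): registers X_0, X_1, ... holding integers,
   all initially 0, a read-only input tape and a write-only output tape of
   integers, and one time unit per executed instruction. *)
Inductive instr :=
| IConst of nat & int         (* X_i <- c *)
| IAdd of nat & nat & nat     (* X_i <- X_j + X_k *)
| ISub of nat & nat & nat     (* X_i <- X_j - X_k *)
| ILoad of nat & nat          (* X_i <- X_(X_j) *)
| IStore of nat & nat         (* X_(X_i) <- X_j *)
| IJumpPos of nat & nat       (* go to instruction l if X_j > 0 *)
| IRead of nat                (* X_i <- next input integer *)
| IPrint of nat               (* output X_i *)
| IHalt.

Definition program := seq instr.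

Record config := Config {
  pc : nat;
  reg : nat -> int;
  input : seq int;
  output : seq int
}.

Definition initial (w : seq int) : config :=
  Config 0 (fun=> 0%R) w [::].

(* Running past the end of the program counts as Halt. *)
Definition fetch (p : program) (c : config) : instr := nth IHalt p (pc c).

Definition set_reg (c : config) (i : nat) (v : int) : config :=
  Config (pc c).+1 [eta reg c with i |-> v] (input c) (output c).

(* None means that no step is possible: either the machine has halted, or it
   has crashed, by using a negative address or reading past the end of the
   input. *)
Definition step (p : program) (c : config) : option config :=
  let: Config k X inp out := c in
  match fetch p c with
  | IConst i z => Some (set_reg c i z)
  | IAdd i j l => Some (set_reg c i (X j + X l)%R)
  | ISub i j l => Some (set_reg c i (X j - X l)%R)
  | ILoad i j => if X j is Posz a then Some (set_reg c i (X a)) else None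
  | IStore i j => if X i is Posz a then Some (set_reg c a (X j)) else None
  | IJumpPos l j =>
      Some (Config (if (0 < X j)%R then l else k.+1) X inp out)
  | IRead i =>
      if inp is z :: inp' then
        Some (Config k.+1 [eta X with i |-> z] inp' out)
      else None
  | IPrint i => Some (Config k.+1 X inp (rcons out (X i)))
  | IHalt => None
  end.

(* run p t c = Some w iff p, started in c, reaches IHalt after at most t steps
   with output w; crashing or running for too long gives None. *)
Fixpoint run (p : program) (t : nat) (c : config) : option (seq int) :=
  if fetch p c is IHalt then Some (output c)
  else if t is t'.+1 then obind (run p t') (step p c) else None.

(* A list of machine integers is written as its length followed by its items;
   an element x of a poset is represented by the number [name x]. *)
Section Encoding.
Context {T : eqType}.
Variable name : T -> nat.

Definition encode_elements (s : seq T) : seq int :=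
  Posz (size s) :: [seq Posz (name x) | x <- s].

Definition encode_pairs (r : seq (T * T)) : seq int :=
  Posz (size r) :: flatten [seq [:: Posz (name q.1); Posz (name q.2)] | q <- r].

End Encoding.

(* w encodes the poset T: the list s of its elements and the list r of all its
   pairs x < y, both in arbitrary order and without repetitions. *)
Definition encodes_poset {d : Order.disp_t} (T : finPOrderType d)
    (name : T -> nat) (w : seq int) : Prop :=
  exists (s : seq T) (r : seq (T * T)),
    [/\ perm_eq s (enum T), perm_eq r (enum (lt_pairs [set: T] [set: T]))
      & w = encode_elements name s ++ encode_pairs name r].

(* w encodes (B, U): a list of the elements of B, then one of those of U. *)
Definition encodes_cut {T : finType} (name : T -> nat) (B U : {set T})
    (w : seq int) : Prop :=
  exists s t : seq T,
    [/\ perm_eq s (enum B), perm_eq t (enum U)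
      & w = encode_elements name s ++ encode_elements name t].

(* Main.v *)
Require Import Defs.
From mathcomp Require Import all_boot all_order all_algebra.
From mathcomp Require Import zify ring.

(* Let excess x = #{y > x} - #{y < x}. It strictly decreases along the order, so
   B = {excess > 0} is a down-set; no pair goes up from U to B, and summing excess
   over B and -excess over U gives 2 e(B, U) = sum_x |excess x|. Now take out the
   elements one by one, each time one with smallest |excess| among those left:
   everything below it has positive and everything above it negative excess, so
   this removes from sum |excess| at least the number of pairs it removes. Hence
   sum_x |excess x| >= e(P, P).

   In a chain with m elements e(P, P) = m (m - 1) / 2, while every cut has size at
   most |B| |U| <= m^2 / 4.

   The machine tabulates excess while it reads the list of pairs, using the name
   of an element as an address. *)

Set Implicit Arguments.
Unset Strict Implicit.
Unset Printing Implicit Defensive.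

Import Order.TTheory GRing.Theory Num.Theory.

(** * The balanced cut *)

Section BalancedCut.
Context {d : Order.disp_t} {T : finPOrderType d}.
Implicit Types (A B U : {set T}) (x y z : T).

Definition above A x := #|[set y in A | (x < y)%O]|.
Definition below A x := #|[set y in A | (y < x)%O]|.
Definition excess A x : int := (above A x)%:Z - (below A x)%:Z.

Lemma num_pairs_above A B : num_pairs A B = \sum_(x in A) above B x.
Proof.
rewrite /num_pairs /lt_pairs -sum1_card.
under eq_bigl do rewrite inE.
rewrite -(pair_big_dep (fun x => x \in A) (fun x y => (y \in B) && (x < y)%O)
  (fun _ _ => 1)) /=.
by apply: eq_bigr => x _; rewrite /above -sum1_card; apply: eq_bigl => y; rewrite inE.
Qed.

Lemma num_pairs_below A B : num_pairs A B = \sum_(y in B) below A y.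
Proof.
rewrite num_pairs_above.
under eq_bigr do rewrite /above -sum1_card.
under [RHS]eq_bigr do rewrite /below -sum1_card.
rewrite (exchange_big_dep (fun y => y \in B)) /=; last first.
  by move=> x y _; rewrite inE => /andP[].
apply: eq_bigr => y yB; apply: eq_bigl => x; rewrite !inE yB.
by [].
Qed.

(** By transitivity everything above [y] is above [x], and [y] itself is above [x] but not above
    [y]; dually [x] is below [y] only. Both terms of the excess therefore change strictly and in the
    same direction. *)
Lemma excess_lt A x y : x \in A -> y \in A -> (x < y)%O ->
  (excess A y < excess A x)%R.
Proof.
move=> xA yA xy.
have lt_above : above A y < above A x.
  apply/proper_card/properP; split.
    apply/subsetP => z; rewrite !inE => /andP[-> yz] /=.
    exact: lt_trans yz.
  by exists y; rewrite !inE yA ?xy // ltxx.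
have lt_below : below A x < below A y.
  apply/proper_card/properP; split.
    apply/subsetP => z; rewrite !inE => /andP[-> zx] /=.
    exact: lt_trans xy.
  by exists x; rewrite !inE xA ?xy // ltxx.
rewrite /excess; lia.
Qed.

Lemma above_rem A x y : x \in A -> above A y = (y < x)%O + above (A :\ x) y.
Proof.
move=> xA; rewrite /above (cardsD1 x) inE xA; congr (_ + _).
by apply: eq_card => z; rewrite !inE andbA.
Qed.

Lemma below_rem A x y : x \in A -> below A y = (x < y)%O + below (A :\ x) y.
Proof.
move=> xA; rewrite /below (cardsD1 x) inE xA; congr (_ + _).
by apply: eq_card => z; rewrite !inE andbA.
Qed.

Lemma above_sum A x : above A x = \sum_(y in A) (x < y)%O.
Proof.
rewrite /above -sum1_card big_mkcond [RHS]big_mkcond.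
by apply: eq_bigr => y _; rewrite inE; case: (y \in A); case: (x < y)%O.
Qed.

Lemma below_sum A x : below A x = \sum_(y in A) (y < x)%O.
Proof.
rewrite /below -sum1_card big_mkcond [RHS]big_mkcond.
by apply: eq_bigr => y _; rewrite inE; case: (y \in A); case: (y < x)%O.
Qed.

Lemma num_pairs_rem A x : x \in A ->
  num_pairs A A = above A x + below A x + num_pairs (A :\ x) (A :\ x).
Proof.
move=> xA; rewrite !num_pairs_above (big_setD1 _ xA) /=.
under eq_bigr do rewrite (above_rem _ xA).
by rewrite big_split /= -below_sum [below A x](below_rem _ xA) ltxx addnA.
Qed.

Lemma sum_abs_excess A : num_pairs A A <= \sum_(x in A) `|excess A x|%N.
Proof.
have [n] := ubnP #|A|; elim: n A => // n IHn A /ltnSE leAn.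
have [->|[x0 x0A]] := set_0Vmem A; first by rewrite num_pairs_above !big_set0.
have [x xA xmin] := arg_minnP (fun x => `|excess A x|%N) x0A.
have {}xA : x \in A by [].
rewrite (num_pairs_rem xA) (big_setD1 _ xA) /=.
(* If [x < y], then [excess A y >= 0] would give [excess A x > excess A y >= 0], against the
   minimality of [x]. So [excess A y] is negative, and deleting [x] from below [y] raises it by one,
   lowering its absolute value by exactly one. The case [y < x] is symmetric. *)
have step y : y \in A :\ x ->
    `|excess A y|%N = `|excess (A :\ x) y|%N + (x < y)%O + (y < x)%O.
  rewrite !inE => /andP[ynx yA]; move: (xmin y yA).
  have := @excess_lt A x y xA yA; have := @excess_lt A y x yA xA.
  have := @lt_asym _ _ x y.
  rewrite /excess (above_rem y xA) (below_rem y xA).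
  case: (x < y)%O => /=; case: (y < x)%O => //= _; lia.
rewrite (eq_bigr _ step) !big_split /= -above_sum -below_sum.
rewrite (above_rem x xA) (below_rem x xA) ltxx !add0n.
have /IHn : #|A :\ x| < n by move: leAn; rewrite (cardsD1 x A) xA.
by move: (\sum_(y in _) _) => S; lia.
Qed.

Definition lower_half : {set T} := [set x | (0 < excess setT x)%R].

Lemma lower_half_closed x y : (x < y)%O -> y \in lower_half -> x \in lower_half.
Proof.
move=> xy; rewrite !inE => ypos; apply: lt_trans ypos _.
by apply: excess_lt; rewrite ?inE.
Qed.

Lemma above_split B x : above setT x = above B x + above (~: B) x.
Proof.
rewrite /above -(cardsID B); congr (_ + _); apply: eq_card => y.
  by rewrite !inE andbC.
by rewrite !inE.
Qed.

Lemma below_split B x : below setT x = below B x + below (~: B) x.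
Proof.
rewrite /below -(cardsID B); congr (_ + _); apply: eq_card => y.
  by rewrite !inE andbC.
by rewrite !inE.
Qed.

Lemma num_pairs_upper_lower : num_pairs (~: lower_half) lower_half = 0.
Proof.
apply/eqP; rewrite cards_eq0; apply/eqP/setP => -[x y]; rewrite in_set0 inE.
apply/negP => /and3P[/= xU yL xy]; move: xU.
by rewrite inE (lower_half_closed xy yL).
Qed.

Lemma is_cut_setC B : is_cut B (~: B).
Proof. by rewrite /is_cut setUCr setICr !eqxx. Qed.

Lemma num_all_pairs_lower_half :
  num_all_pairs T <= 2 * num_pairs lower_half (~: lower_half).
Proof.
rewrite /num_all_pairs; apply: leq_trans (sum_abs_excess _) _.
set L := lower_half; have UL := num_pairs_upper_lower; rewrite -/L in UL.
rewrite (eq_bigl _ _ (in_setT (T := T))) (bigID (mem L)) /= mul2n -addnn leq_add //.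
  (* Adding the [below] terms on both sides avoids subtraction. Pairs inside [L] are then counted
     once at each end and cancel, and no pair goes up from the complement to [L], so only
     [num_pairs L (~: L)] remains. The other half of the sum is treated dually. *)
  rewrite -(leq_add2r (\sum_(x in L) below setT x)) -big_split /=.
  rewrite (eq_bigr (above setT)) => [|x]; last first.
    by rewrite !inE /excess; lia.
  under eq_bigr do rewrite (above_split L).
  under [X in _ <= _ + X]eq_bigr do rewrite (below_split L).
  by rewrite !big_split /= -!num_pairs_above -!num_pairs_below UL addn0 addnC.
under eq_bigl do rewrite -in_setC.
rewrite -(leq_add2r (\sum_(x in ~: L) above setT x)) -big_split /=.
rewrite (eq_bigr (below setT)) => [|x]; last first.
  by rewrite !inE /excess; lia.
under eq_bigr do rewrite (below_split L).
under [X in _ <= _ + X]eq_bigr do rewrite (above_split L).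
by rewrite !big_split /= -!num_pairs_above -!num_pairs_below UL.
Qed.

End BalancedCut.

(** * Bounds for the largest cut, and the number of pairs in a chain *)

Section MaxCut.
Context {d : Order.disp_t}.

Lemma max_cut_card (T : finPOrderType d) : 4 * max_cut T <= #|T| * #|T|.
Proof.
rewrite mulnC -leq_divRL //; apply/bigmax_leqP => -[B U] /= /andP[/eqP BU /eqP BIU].
rewrite leq_divRL //; have cardT : #|B| + #|U| = #|T|.
  by rewrite -cardsUI BU BIU cardsT cards0 addn0.
have : num_pairs B U <= #|B| * #|U|.
  rewrite -cardsX; apply/subset_leq_card/fintype.subsetP => -[x y].
  by rewrite !inE /= => /and3P[-> ->].
move=> le_BU; apply: (@leq_trans (4 * (#|B| * #|U|))); first by rewrite mulnC leq_mul2l.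
by rewrite -cardT mulnn nat_AGM2.
Qed.

Lemma num_all_pairs_max_cut (T : finPOrderType d) :
  num_all_pairs T <= 2 * max_cut T.
Proof.
apply: leq_trans (num_all_pairs_lower_half) _; rewrite leq_mul2l /=.
by apply: (@leq_bigmax_cond _ (fun c => is_cut c.1 c.2)
  (fun c : {set T} * {set T} => num_pairs c.1 c.2)
  (lower_half, ~: lower_half)); apply: is_cut_setC.
Qed.

(** Counting each pair at both of its ends gives [above + below] at every [x], and in a total order
    [x] is comparable to each of the [#|T|.-1] other elements. *)
Lemma num_all_pairs_total (T : finOrderType d) :
  2 * num_all_pairs T = #|T| * #|T|.-1.
Proof.
rewrite mul2n -addnn {1}/num_all_pairs num_pairs_above.
rewrite /num_all_pairs num_pairs_below -big_split /=.
rewrite (eq_bigr (fun=> #|T|.-1)) => [|x _].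
  by rewrite sum_nat_const cardsT.
rewrite /above /below -[RHS](cardC1 x).
rewrite -cardsUI (_ : #|_ :&: _| = 0) ?addn0; last first.
  apply/eqP; rewrite cards_eq0; apply/eqP/setP => y; rewrite !inE.
  by case: (ltgtP x y).
by apply: eq_card => y; rewrite !inE; case: (ltgtP x y).
Qed.
End MaxCut.

Lemma num_all_pairs_ord n : 2 * num_all_pairs 'I_n = n * n.-1.
Proof. by have := num_all_pairs_total 'I_n; rewrite card_ord. Qed.

(** * Structured programs for the random access machine *)

(** A configuration without its program counter, so that commands can be specified independently of
    their address. *)
Definition state := ((nat -> int) * seq int * seq int)%type.

Definition at_pc (k : nat) (st : state) : config :=
  let: (X, inp, out) := st in Config k X inp out.

Definition upd (X : nat -> int) (i : nat) (v : int) : nat -> int :=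
  [eta X with i |-> v].

(** Only instructions that fall through have an effect here; jumps enter programs through [Unless]
    and [Repeat] alone. *)
Definition effect (i : instr) (st : state) : option state :=
  let: (X, inp, out) := st in
  match i with
  | IConst i z => Some (upd X i z, inp, out)
  | IAdd i j l => Some (upd X i (X j + X l)%R, inp, out)
  | ISub i j l => Some (upd X i (X j - X l)%R, inp, out)
  | ILoad i j =>
      if X j is Posz a then Some (upd X i (X a), inp, out) else None
  | IStore i j =>
      if X i is Posz a then Some (upd X a (X j), inp, out) else None
  | IRead i =>
      if inp is z :: inp' then Some (upd X i z, inp', out) else None
  | IPrint i => Some (X, inp, rcons out (X i))
  | IJumpPos _ _ | IHalt => None
  end.

Fixpoint effects (l : seq instr) (st : state) : option state :=
  if l is i :: l' then obind (effects l') (effect i st) else Some st.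

Definition ends_in (l : seq instr) (Q : state -> Prop) (st : state) : Prop :=
  if effects l st is Some st' then Q st' else False.

Inductive cmd :=
| Do of seq instr
| Seq of cmd & cmd
| Unless of nat & cmd      (* skip the command if the register is positive *)
| Repeat of cmd & nat.     (* do ... while the register is positive *)

Fixpoint csize (c : cmd) : nat :=
  match c with
  | Do l => size l
  | Seq c1 c2 => csize c1 + csize c2
  | Unless _ c => (csize c).+1
  | Repeat c _ => (csize c).+1
  end.

(** Jump targets are absolute, hence the start address [k]. The target of [Unless] counts the test
    itself and then the body, which is the first address after both. *)
Fixpoint compile (c : cmd) (k : nat) : seq instr :=
  match c with
  | Do l => l
  | Seq c1 c2 => compile c1 k ++ compile c2 (k + csize c1)
  | Unless j c => IJumpPos (k + (csize c).+1) j :: compile c k.+1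
  | Repeat c j => rcons (compile c k) (IJumpPos k j)
  end.

Lemma size_compile c k : size (compile c k) = csize c.
Proof.
elim: c k => //= [c1 IH1 c2 IH2|j c IHc|c IHc j] k.
- by rewrite size_cat IH1 IH2.
- by rewrite IHc.
- by rewrite size_rcons IHc.
Qed.

Definition code_at (p : program) (k : nat) (l : seq instr) : Prop :=
  forall i, i < size l -> nth IHalt p (k + i) = nth IHalt l i.

Lemma code_at_cat p k l1 l2 :
  code_at p k (l1 ++ l2) -> code_at p k l1 /\ code_at p (k + size l1) l2.
Proof.
move=> pl; split=> i il.
  by rewrite pl ?nth_cat ?il // size_cat ltn_addr.
by rewrite -addnA pl ?size_cat ?ltn_add2l // nth_cat ltnNge leq_addr addKn.
Qed.

Lemma code_at_cons p k i l :
  code_at p k (i :: l) -> nth IHalt p k = i /\ code_at p k.+1 l.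
Proof.
rewrite -cat1s => /code_at_cat[pi pl]; split.
  by rewrite -[k]addn0 pi.
by rewrite addn1 in pl.
Qed.

Lemma run_mono p t t' c w : t <= t' -> run p t c = Some w -> run p t' c = Some w.
Proof.
elim: t t' c => [|t IHt] [|t'] c //= tt'; case: (fetch p c) => //.
all: by intros; case: (step p c) H => //= c'; apply: IHt.
Qed.

(* wp c t Q st: started in st, the code of c, placed anywhere in a program,
   falls through in at most t steps in a state satisfying Q. The halting time
   of the rest of the program appears as t0, so that no trace is needed. *)
Definition wp (c : cmd) (t : nat) (Q : state -> Prop) (st : state) : Prop :=
  forall p k t0 w, code_at p k (compile c k) ->
  (forall st', Q st' -> run p t0 (at_pc (k + csize c) st') = Some w) ->
  run p (t + t0) (at_pc k st) = Some w.

Lemma wp_weaken c t t' (Q Q' : state -> Prop) st :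
  t <= t' -> (forall st', Q st' -> Q' st') -> wp c t Q st -> wp c t' Q' st.
Proof.
move=> tt' QQ' ct p k t0 w pk pQ; apply: (@run_mono _ (t + t0)).
  by rewrite leq_add2r.
by apply: ct => // st' /QQ'; apply: pQ.
Qed.

Lemma run_effect p k t i st st' :
  nth IHalt p k = i -> effect i st = Some st' ->
  run p t.+1 (at_pc k st) = run p t (at_pc k.+1 st').
Proof.
case: st => [[X inp] out] pk /=; rewrite /step /fetch /= pk.
case: i pk => [i z|i j l|i j l|i j|i j|l j|i|i|] //= _.
all: try by case=> <-.
all: try by case: (X _) => // a [<-].
by case: inp => // z inp' [<-].
Qed.

Lemma run_jump p k t l j X inp out :
  nth IHalt p k = IJumpPos l j ->
  run p t.+1 (at_pc k (X, inp, out))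
    = run p t (at_pc (if (0 < X j)%R then l else k.+1) (X, inp, out)).
Proof. by move=> pk; rewrite /= /fetch /= pk. Qed.

Lemma wp_do l (Q : state -> Prop) st :
  ends_in l Q st -> wp (Do l) (size l) Q st.
Proof.
rewrite /ends_in; case lst: (effects l st) => [st'|] // Qst' p k t w pk pQ.
elim: l st k lst pk pQ => [|i l IHl] st k.
  by case=> -> _ pQ; have := pQ _ Qst'; rewrite addn0.
rewrite [effects _ _]/=; case ist: (effect i st) => [st1|] // lst1.
move=> /code_at_cons[pki pkl] pQ; rewrite [size _]/=.
rewrite addSn (run_effect _ pki ist).
apply: IHl => // st2 Qst2; rewrite addSnnS; exact: pQ.
Qed.

Lemma wp_seq c1 c2 t1 t2 (Q : state -> Prop) st :
  wp c1 t1 (wp c2 t2 Q) st -> wp (Seq c1 c2) (t1 + t2) Q st.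
Proof.
move=> c12 p k t0 w /= /code_at_cat[]; rewrite size_compile => pk1 pk2 pQ.
rewrite -addnA; apply: c12 pk1 _ => st' c2Q.
by apply: c2Q pk2 _ => st2 Qst2; rewrite -addnA; apply: pQ.
Qed.

Lemma wp_unless j c t (Q : state -> Prop) X inp out :
  ((0 < X j)%R -> Q (X, inp, out)) ->
  (~~ (0 < X j)%R -> wp c t Q (X, inp, out)) ->
  wp (Unless j c) t.+1 Q (X, inp, out).
Proof.
move=> skip nskip p k t0 w /code_at_cons[pki pkl] pQ.
rewrite addSn (run_jump _ _ _ _ pki).
case: ifP => [/skip/pQ|/negbT/nskip wpc].
  by apply: run_mono; rewrite leq_addl.
by apply: wpc pkl _ => st' /pQ; rewrite addSnnS.
Qed.

(** [Inv k] describes the state with [k] rounds to go and fixes the tested register to [k], so the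
    jump back is taken exactly while rounds remain. The body runs at least once, hence [n.+1]; each
    round costs [t] plus one jump. *)
Lemma wp_repeat j c t (Inv : nat -> state -> Prop) n st :
  (forall k X inp out, Inv k (X, inp, out) -> X j = k) ->
  (forall k st', Inv k.+1 st' -> wp c t (Inv k) st') ->
  Inv n.+1 st -> wp (Repeat c j) (n.+1 * t.+1) (Inv 0) st.
Proof.
move=> Invj body; elim: n st => [|n IHn] st /body cst p k t0 w pk pQ.
all: have := pk; rewrite -[compile _ _]/(rcons _ _) -cats1.
all: move=> /code_at_cat[pkc] /code_at_cons[]; rewrite size_compile => pkj _.
all: rewrite mulSn addSn -addnS -?addnA; apply: cst (pkc) _ => -[[X inp] out] Inv_st.
all: rewrite ?addSn (run_jump _ _ _ _ pkj) (Invj _ _ _ _ Inv_st).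
  by have := pQ _ Inv_st; rewrite addnS.
exact: IHn pk pQ.
Qed.

Lemma wp_then c1 c2 t1 t2 (R Q : state -> Prop) st :
  wp c1 t1 R st -> (forall st', R st' -> wp c2 t2 Q st') ->
  wp (Seq c1 c2) (t1 + t2) Q st.
Proof. by move=> c1R RQ; apply/wp_seq/(wp_weaken (leqnn t1) RQ). Qed.

(* Registers; lst and tab hold the offsets of the two arrays, zro stays 0. *)
Definition one := 0.
Definition len := 1.
Definition ctr := 2.
Definition tmp := 3.
Definition elt := 4.
Definition adr := 5.
Definition vlu := 6.
Definition lst := 7.
Definition tab := 8.
Definition zro := 9.
Definition cnt := 10.

(** [Repeat] always executes its body once. The guard computes [1 - ctr], which is positive exactly
    when the counter is not, and then skips the loop. *)
Definition While (c : cmd) : cmd :=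
  Seq (Do [:: ISub tmp one ctr]) (Unless tmp (Repeat c ctr)).

(** The additional 2 pays for the subtraction and the guard. The guard overwrites [tmp], so the
    invariant must survive any value there. *)
Lemma wp_while c t (Inv : nat -> state -> Prop) n st :
  (forall k X inp out, Inv k (X, inp, out) -> X ctr = k /\ X one = 1%R) ->
  (forall k X inp out v, Inv k (X, inp, out) -> Inv k (upd X tmp v, inp, out)) ->
  (forall k st', Inv k.+1 st' -> wp c t (Inv k) st') ->
  Inv n st -> wp (While c) (n * t.+1 + 2) (Inv 0) st.
Proof.
case: st => [[X inp] out] Inv_regs Inv_tmp body Inv_n.
rewrite addnC -[2]/(1 + 1) -addnA [X in _ + X]add1n.
have [Xctr Xone] := Inv_regs _ _ _ _ Inv_n.
apply/wp_seq/wp_do => //; apply: wp_unless; rewrite /upd /= Xctr Xone => n0.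
  have -> : 0 = n by lia.
  exact: Inv_tmp.
case: n {Xctr} Inv_n n0 => [|n] Inv_n n0; first by lia.
apply: wp_repeat body _ => [k X' inp' out' /Inv_regs[]//|].
exact: Inv_tmp.
Qed.

Section StraightLine.
Variables (l : seq instr) (Q : state -> Prop) (X : nat -> int) (inp out : seq int).
Implicit Types (i j k a : nat) (v : int).

Lemma ends_in_const i v :
  ends_in l Q (upd X i v, inp, out) ->
  ends_in (IConst i v :: l) Q (X, inp, out).
Proof. by []. Qed.

Lemma ends_in_add v i j k :
  (X j + X k)%R = v -> ends_in l Q (upd X i v, inp, out) ->
  ends_in (IAdd i j k :: l) Q (X, inp, out).
Proof. by move<-. Qed.

Lemma ends_in_sub v i j k :
  (X j - X k)%R = v -> ends_in l Q (upd X i v, inp, out) ->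
  ends_in (ISub i j k :: l) Q (X, inp, out).
Proof. by move<-. Qed.

(** Taking the address and the value through equations lets each use supply them in simplified form;
    that [a] is a natural number rules out a crash. *)
Lemma ends_in_load a v i j :
  X j = a -> X a = v -> ends_in l Q (upd X i v, inp, out) ->
  ends_in (ILoad i j :: l) Q (X, inp, out).
Proof. by rewrite /ends_in /= => -> ->. Qed.

Lemma ends_in_store a v i j :
  X i = a -> X j = v -> ends_in l Q (upd X a v, inp, out) ->
  ends_in (IStore i j :: l) Q (X, inp, out).
Proof. by rewrite /ends_in /= => -> ->. Qed.

Lemma ends_in_read i v :
  ends_in l Q (upd X i v, inp, out) ->
  ends_in (IRead i :: l) Q (X, v :: inp, out).
Proof. by []. Qed.

Lemma ends_in_print v i :
  X i = v -> ends_in l Q (X, inp, rcons out v) ->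
  ends_in (IPrint i :: l) Q (X, inp, out).
Proof. by move<-. Qed.

End StraightLine.

Lemma ends_in_cat l1 l2 Q st :
  ends_in l1 (ends_in l2 Q) st -> ends_in (l1 ++ l2) Q st.
Proof.
rewrite /ends_in; elim: l1 st => //= i l1 IHl st.
by case: (effect i st) => //= st'; apply: IHl.
Qed.

(** * Memory layout and the loops of the algorithm *)

Section Layout.
Variable n : nat.
Implicit Types (l : seq nat) (g : nat -> int) (k a x : nat) (c v : int).
Implicit Types (X : nat -> int) (Q : state -> Prop).

(* The i-th element read is stored at address [11 + 2 * (n - i)], so that the
   loop counter k, which runs from n down to 1, determines the address; the
   table entry of the element named a is at address [12 + 2 * a]. *)
Definition layout l g k c X : Prop :=
  [/\ [/\ X one = 1%R, X len = n, X lst = 11, X tab = 12 & X zro = 0%R],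
      X ctr = k /\ X cnt = c,
      forall i, i < size l -> X ((n - i) + (n - i) + 11) = nth 0 l i
    & forall a, X (a + a + 12) = g a].

Lemma layout_scratch l g k c X j v :
  j \in [:: tmp; elt; adr; vlu] ->
  layout l g k c X -> layout l g k c (upd X j v).
Proof.
rewrite /layout /upd => js [Xregs Xvars Xl Xg].
have j11 : j < 11 :=
  allP (isT : all (fun j => j < 11) [:: tmp; elt; adr; vlu]) j js.
split=> [||i il|a] /=.
- by move: js; rewrite !inE; repeat case/orP; try move/eqP->.
- by move: js; rewrite !inE; repeat case/orP; try move/eqP->.
- by case: eqP => [|_]; [lia | exact: Xl].
- by case: eqP => [|_]; [lia | exact: Xg].
Qed.

Lemma layout_ctr l g k c X k' :
  layout l g k c X -> layout l g k' c (upd X ctr k').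
Proof.
rewrite /layout /upd => -[Xregs [_ Xc] Xl Xg]; split=> [||i il|a] //=.
- by case: eqP => [|_]; [rewrite /ctr; lia | exact: Xl].
- by case: eqP => [|_]; [rewrite /ctr; lia | exact: Xg].
Qed.

Lemma layout_cnt l g k c X c' :
  layout l g k c X -> layout l g k c' (upd X cnt c').
Proof.
rewrite /layout /upd => -[Xregs [Xk _] Xl Xg]; split=> [||i il|a] //=.
- by case: eqP => [|_]; [rewrite /cnt; lia | exact: Xl].
- by case: eqP => [|_]; [rewrite /cnt; lia | exact: Xg].
Qed.

(** List cells have odd addresses and table cells even ones, all beyond the registers, so the two
    arrays interleave without collision however large the names are. *)
Lemma layout_rcons l g k c X m x :
  m = n - size l -> size l < n -> layout l g k c X ->
  layout (rcons l x) g k c (upd X (m + m + 11) x).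
Proof.
rewrite /layout /upd => -> ln [Xregs Xvars Xl Xg].
have far j : (j < 11) -> (j == n - size l + (n - size l) + 11) = false by lia.
split=> [||i|a] /=.
- by rewrite !far.
- by rewrite !far.
- rewrite size_rcons nth_rcons => il; case: (ltngtP i (size l)) => [lti|ltl|->].
  + by rewrite ifN; [exact: Xl | lia].
  + by lia.
  + by rewrite eqxx.
- by case: eqP => [|_]; [lia | exact: Xg].
Qed.

Lemma layout_table l g g' k c X a :
  (forall b, b != a -> g' b = g b) -> layout l g k c X ->
  layout l g' k c (upd X (a + a + 12) (g' a)).
Proof.
rewrite /layout /upd => g'E [Xregs Xvars Xl Xg].
have far j : (j < 11) -> (j == a + a + 12) = false by lia.
split=> [||i il|b] /=.
- by rewrite !far.
- by rewrite !far.
- by case: eqP => [|_]; [lia | exact: Xl].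
- case: (eqVneq b a) => [->|ba]; first by rewrite eqxx.
  by rewrite (g'E b) // -Xg ifN //; lia.
Qed.

Definition read_elements : cmd :=
  While (Do [:: IRead elt; IAdd adr ctr ctr; IAdd adr adr lst;
                IStore adr elt; ISub ctr ctr one]).

Lemma wp_read_elements ns inp X :
  size ns = n -> layout [::] (fun=> 0%R) n 0 X ->
  wp read_elements (n * 6 + 2)
    (fun st => exists2 X', st = (X', inp, [::]) & layout ns (fun=> 0%R) 0 0 X')
    (X, [seq Posz a | a <- ns] ++ inp, [::]).
Proof.
move=> size_ns lX.
(* With [k] rounds to go, the first [n - k] elements are stored and the others are still on the
   tape. A round takes five instructions and the loop jump, hence the factor 6. *)
pose Inv k (st : state) := k <= n /\ exists2 X',
  st = (X', [seq Posz a | a <- drop (n - k) ns] ++ inp, [::]) &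
  layout (take (n - k) ns) (fun=> 0%R) k 0 X'.
apply: (@wp_weaken _ _ _ (Inv 0) _ _ (leqnn _)) => [_ [_ [X' ->]]|].
  rewrite subn0 -size_ns drop_size take_size => lX'.
  by exists X'.
apply: wp_while.
- by move=> k X1 i o [_ [X' [-> _ _] [[? _ _ _ _] []]]].
- move=> k X1 i o v [kn [X' [-> -> ->] lX']]; split=> //.
  by exists (upd X' tmp v) => //; apply: layout_scratch.
- move=> k _ [kn [X' -> lX']].
  have kns : n - k.+1 < size ns by rewrite size_ns; lia.
  rewrite (drop_nth 0 kns) [map _ _]/= cat_cons.
  have [[X0 X1 X7 X8 X9] [Xk Xc] Xl Xg] := lX'.
  apply: wp_do; apply: ends_in_read.
  apply: (@ends_in_add _ _ _ _ _ (k.+1 + k.+1)); first by rewrite /upd /= Xk.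
  apply: (@ends_in_add _ _ _ _ _ (k.+1 + k.+1 + 11)); first by rewrite /upd /= X7.
  apply: (ends_in_store (a := k.+1 + k.+1 + 11) (v := nth 0 ns (n - k.+1))) => //.
  apply: (ends_in_sub (v := k)).
    have far j : j < 11 -> (j == k.+1 + k.+1 + 11) = false by lia.
    by rewrite /upd /= !far // Xk X0; lia.
  split; first exact: ltnW.
  rewrite (_ : n - k = (n - k.+1).+1); last by lia.
  rewrite (take_nth 0) //; eexists; first by [].
  apply: layout_ctr; apply: layout_rcons; rewrite ?size_take ?kns; try lia.
  by do 3!apply: layout_scratch => //; exact: lX'.
- split=> //; exists X; first by rewrite subnn drop0.
  by rewrite subnn take0.
Qed.

Definition bump (up : bool) : seq instr :=
  [:: IRead elt; IAdd adr elt elt; IAdd adr adr tab; ILoad vlu adr;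
      if up then IAdd vlu vlu one else ISub vlu vlu one; IStore adr vlu].

(** The power of [-1] is the sign of the update. The new table [g'] is described pointwise, so no
    equality of functions is needed. *)
Lemma ends_in_bump up g' Q l g k c X a inp out :
  layout l g k c X ->
  g' =1 (fun b => g b + (-1) ^+ (~~ up) * (b == a)%:Z)%R ->
  (forall X', layout l g' k c X' -> Q (X', inp, out)) ->
  ends_in (bump up) Q (X, Posz a :: inp, out).
Proof.
move=> lX g'E Q_layout; have [[X0 X1 X7 X8 X9] [Xk Xc] Xl Xg] := lX.
have far j : j < 11 -> (a + a + 12 == j) = false by lia.
apply: ends_in_read.
apply: (@ends_in_add _ _ _ _ _ (a + a)%N); first by [].
apply: (@ends_in_add _ _ _ _ _ (a + a + 12)); first by rewrite /upd /= X8.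
apply: (ends_in_load (a := a + a + 12) (v := g a)) => //.
  by rewrite /upd /= !far.
have g'a : g' a = (if up then (g a + 1) else (g a - 1))%R.
  by rewrite g'E eqxx; case: (up); rewrite ?expr0 ?expr1 ?mul1r ?mulN1r.
case: up g'E g'a => g'E g'a;
  [apply: (ends_in_add (v := g' a)) | apply: (ends_in_sub (v := g' a))].
1,3: by rewrite g'a /upd /= X0.
all: apply: (ends_in_store (a := a + a + 12) (v := g' a)) => //.
all: apply: Q_layout; apply: (@layout_table _ g).
1,3: by move=> b /negbTE ba; rewrite g'E ba mulr0 addr0.
all: by do 5!apply: layout_scratch => //.
Qed.

(** [vlu] receives the table entry and [tmp] receives one minus it, so exactly one of them is
    positive: skipping on [tmp] keeps the elements of positive excess, skipping on [vlu] keeps the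
    others. *)
Definition fetch_elt : seq instr :=
  [:: IAdd adr ctr ctr; IAdd adr adr lst; ILoad elt adr;
      IAdd adr elt elt; IAdd adr adr tab; ILoad vlu adr;
      ISub tmp one vlu; ISub ctr ctr one].

Lemma ends_in_fetch Q l g k c X inp out :
  size l = n -> k < n -> layout l g k.+1 c X ->
  (forall X', layout l g k c X' -> X' elt = nth 0 l (n - k.+1) ->
    X' vlu = g (nth 0 l (n - k.+1)) ->
    X' tmp = (1 - g (nth 0 l (n - k.+1)))%R -> Q (X', inp, out)) ->
  ends_in fetch_elt Q (X, inp, out).
Proof.
move=> size_l kn lX Q_layout; have [[X0 X1 X7 X8 X9] [Xk Xc] Xl Xg] := lX.
have far11 j b : j < 11 -> (b + b + 11 == j) = false by lia.
have far12 j b : j < 11 -> (b + b + 12 == j) = false by lia.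
set x := nth _ _ _ in Q_layout *.
apply: (@ends_in_add _ _ _ _ _ (k.+1 + k.+1)); first by rewrite /upd /= Xk.
apply: (@ends_in_add _ _ _ _ _ (k.+1 + k.+1 + 11)); first by rewrite /upd /= X7.
apply: (ends_in_load (a := k.+1 + k.+1 + 11) (v := x)) => //.
  have /Xl : n - k.+1 < size l by rewrite size_l; lia.
  by rewrite /upd /= !far11 // subKn.
apply: (@ends_in_add _ _ _ _ _ (x + x)%N); first by [].
apply: (@ends_in_add _ _ _ _ _ (x + x + 12)); first by rewrite /upd /= X8.
apply: (ends_in_load (a := x + x + 12) (v := g x)) => //.
  by rewrite /upd /= !far12.
apply: (ends_in_sub (v := (1 - g x)%R)); first by rewrite /upd /= X0.
apply: (ends_in_sub (v := k)); first by rewrite /upd /= X0 Xk; lia.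
apply: Q_layout => //.
by apply: (@layout_ctr _ _ k.+1); do 7!apply: layout_scratch => //.
Qed.

(** The excess as the machine sees it, read off from a list of pairs of names. *)
Definition balance (ps : seq (nat * nat)) (a : nat) : int :=
  ((count (fun q => q.1 == a) ps)%:Z - (count (fun q => q.2 == a) ps)%:Z)%R.

Definition unpair (ps : seq (nat * nat)) : seq int :=
  flatten [seq [:: Posz q.1; Posz q.2] | q <- ps].

Definition tabulate_balance : cmd :=
  While (Do (bump true ++ bump false ++ [:: ISub ctr ctr one])).

Lemma wp_tabulate_balance l ps inp out c X :
  layout l (fun=> 0%R) (size ps) c X ->
  wp tabulate_balance (size ps * 14 + 2)
    (fun st => exists2 X', st = (X', inp, out) & layout l (balance ps) 0 c X')
    (X, unpair ps ++ inp, out).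
Proof.
move=> lX; set m := size ps.
pose Inv k (st : state) := k <= m /\ exists2 X',
  st = (X', unpair (drop (m - k) ps) ++ inp, out) &
  layout l (balance (take (m - k) ps)) k c X'.
apply: (@wp_weaken _ _ _ (Inv 0) _ _ (leqnn _)) => [_ [_ [X' ->]]|].
  by rewrite subn0 drop_size take_size => lX'; exists X'.
apply: wp_while.
- by move=> k X1 i o [_ [X' [-> _ _] [[? _ _ _ _] []]]].
- move=> k X1 i o v [km [X' [-> -> ->] lX']]; split=> //.
  by exists (upd X' tmp v) => //; apply: layout_scratch.
- move=> k _ [km [X' -> lX']].
  have kps : m - k.+1 < size ps by rewrite -/m; lia.
  have q0 : nat * nat by [].
  rewrite (drop_nth q0 kps) /unpair [map _ _]/= [flatten _]/= !cat_cons.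
  set q := nth _ _ _.
  apply: wp_do; apply: (@ends_in_cat (bump true)).
  apply: (ends_in_bump lX') => [b|X1 lX1]; first by [].
  apply: (@ends_in_cat (bump false)).
  apply: (ends_in_bump lX1) => [b|X2 lX2]; first by [].
  have [[X20 _ _ _ _] [X2k _] _ _] := lX2.
  apply: (ends_in_sub (v := k)); first by rewrite X2k X20; lia.
  split; first exact: ltnW.
  rewrite (_ : m - k = (m - k.+1).+1); last by lia.
  eexists; first by [].
  apply: (@layout_ctr _ _ k.+1); case: lX2 => X2regs X2vars X2l X2g.
  (* The prefix has grown by the pair [q]; the two bumps account for its first and its second
     component. *)
  split=> // a; rewrite X2g (take_nth q0) // -/q /balance -cats1 !count_cat /=.
  by rewrite !addn0 !PoszD [q.1 == a]eq_sym [q.2 == a]eq_sym /=; lia.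
- split=> //; exists X; first by rewrite subnn drop0.
  rewrite subnn take0; case: lX => Xregs Xvars Xl Xg.
  by split=> // a; rewrite Xg /balance subrr.
Qed.

Definition scan (t : nat) (act : instr) : cmd :=
  While (Seq (Do fetch_elt) (Unless t (Do [:: act]))).

(* [cnt_of s] and [out_of s] are the contents of the register cnt and of the
   output tape once the selected elements seen so far form the list s. *)
Lemma wp_scan t act (sel : pred nat) (cnt_of : seq nat -> int)
    (out_of : seq nat -> seq int) l g inp X :
  (forall X' x, X' vlu = g x -> X' tmp = (1 - g x)%R ->
    (0 < X' t)%R = ~~ sel x) ->
  (forall s x k X', layout l g k (cnt_of s) X' -> X' elt = x ->
    ends_in [:: act] (fun st =>
      exists2 X2, st = (X2, inp, out_of (rcons s x)) &
                  layout l g k (cnt_of (rcons s x)) X2)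
      (X', inp, out_of s)) ->
  size l = n -> layout l g n (cnt_of [::]) X ->
  wp (scan t act) (n * 11 + 2)
    (fun st => exists2 X', st = (X', inp, out_of (filter sel l)) &
                           layout l g 0 (cnt_of (filter sel l)) X')
    (X, inp, out_of [::]).
Proof.
move=> selE actE size_l lX.
pose seen k := filter sel (take (n - k) l).
pose Inv k (st : state) := k <= n /\ exists2 X',
  st = (X', inp, out_of (seen k)) & layout l g k (cnt_of (seen k)) X'.
apply: (@wp_weaken _ _ _ (Inv 0) _ _ (leqnn _)) => [_ [_ [X' ->]]|].
  by rewrite /seen subn0 -size_l take_size => lX'; exists X'.
apply: wp_while.
- by move=> k X1 i o [_ [X' [-> _ _] [[? _ _ _ _] []]]].
- move=> k X1 i o v [kn [X' [-> -> ->] lX']]; split=> //.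
  by exists (upd X' tmp v) => //; apply: layout_scratch.
(* Eight instructions fetch the element and two units cover the guarded action; the loop jump makes
   11 per round. *)
- move=> k _ [kn [X' -> lX']]; apply: (@wp_seq _ _ 8 2); apply: wp_do.
  apply: (ends_in_fetch size_l kn lX') => X1 lX1.
  set x := nth _ _ _ => X1elt X1vlu X1tmp.
  have seenE : seen k = if sel x then rcons (seen k.+1) x else seen k.+1.
    rewrite /seen (_ : n - k = (n - k.+1).+1); last by lia.
    by rewrite (take_nth 0) ?filter_rcons // size_l; lia.
  apply: wp_unless; rewrite (selE _ x) // ?negbK => selx.
    move/negbTE in selx.
    by split; [exact: ltnW | exists X1; rewrite // seenE selx].
  apply: (wp_weaken (leqnn 1)) (wp_do (actE _ _ _ _ lX1 X1elt)).
  move=> _ [X2 -> lX2].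
  by split; [exact: ltnW | exists X2; rewrite // seenE selx].
- by split=> //; exists X; rewrite /seen subnn take0.
Qed.

End Layout.

(** * The complete program and its running time *)

Definition cut_cmd : cmd :=
  Seq (Do [:: IConst one 1; IConst lst 11; IConst tab 12;
              IRead len; IAdd ctr len zro])
 (Seq read_elements
 (Seq (Do [:: IRead ctr])
 (Seq tabulate_balance
 (Seq (Do [:: IAdd ctr len zro])
 (Seq (scan tmp (IAdd cnt cnt one))
 (Seq (Do [:: IPrint cnt; IAdd ctr len zro])
 (Seq (scan tmp (IPrint elt))
 (Seq (Do [:: ISub cnt len cnt; IPrint cnt; IAdd ctr len zro])
      (scan vlu (IPrint elt)))))))))).

(** The output format puts a length before each list, so one scan first counts the selected elements
    and a second one prints them. The length of the other list is obtained by subtraction, and a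
    third scan prints it. *)
Lemma wp_cut_cmd ns ps (sel := fun a => (0 < balance ps a)%R) :
  wp cut_cmd (40 * (size ns + size ps) + 30)
    (fun st => st.2 = encode_elements id (filter sel ns)
                        ++ encode_elements id (filter (predC sel) ns))
    ((fun=> 0%R), encode_elements id ns ++ Posz (size ps) :: unpair ps, [::]).
Proof.
set n := size ns; set m := size ps.
set g := balance ps.
(* The bounds of the phases add up to [39 * n + 14 * m + 22]. *)
apply: (@wp_weaken _ (5 + (n * 6 + 2 + (1 + (m * 14 + 2 + (1 + (n * 11 + 2
  + (2 + (n * 11 + 2 + (3 + (n * 11 + 2))))))))))); [by lia | by move=> st; exact |].
rewrite /encode_elements cat_cons.
pose X0 := upd (upd (upd (upd (upd (fun=> 0%R) one 1) lst 11) tab 12) len n) ctr n.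
apply: (@wp_then _ _ 5 _ (fun st =>
  st = (X0, [seq Posz a | a <- ns] ++ Posz (size ps) :: unpair ps, [::]))).
  apply: wp_do; do 3!apply: ends_in_const; apply: ends_in_read.
  by apply: (ends_in_add (v := n)) => //; rewrite /upd /= addr0.
move=> _ ->.
(* All registers start at 0, so the table needs no clearing; this keeps the time independent of the
   size of the names. *)
have lX0 : layout n [::] (fun=> 0%R) n 0 X0.
  split=> // a; rewrite /X0 /upd /= !ifN //; rewrite ?/one ?/lst ?/tab ?/len ?/ctr; lia.
apply: (wp_then (wp_read_elements _ lX0)) => // _ [X1 -> lX1].
apply: (@wp_then _ _ 1 _ (fun st => exists2 X', st = (X', unpair ps ++ [::], [::]) &
  layout n ns (fun=> 0%R) m 0 X')).
  apply: wp_do; apply: ends_in_read; eexists; first by rewrite cats0.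
  exact: layout_ctr lX1.
move=> _ [X2 -> lX2].
apply: (wp_then (wp_tabulate_balance lX2)) => _ [X3 -> lX3].
apply: (@wp_then _ _ 1 _ (fun st => exists2 X', st = (X', [::], [::]) &
  layout n ns g n 0 X')).
  apply: wp_do; apply: (ends_in_add (v := n)).
    by case: lX3 => [[_ -> _ _ ->] _ _ _]; rewrite addr0.
  by eexists; first by []; apply: layout_ctr lX3.
move=> _ [X4 -> lX4].
have sel_tmp (X' : nat -> int) x :
    X' vlu = g x -> X' tmp = (1 - g x)%R -> (0 < X' tmp)%R = ~~ sel x.
  by rewrite /sel -/g => _ ->; lia.
apply: (wp_then (wp_scan (sel := sel) (cnt_of := fun s => size s)
  (out_of := fun=> [::]) sel_tmp _ _ lX4)) => // [s x k X' lX' _|_ [X5 -> lX5]].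
  apply: (ends_in_add (v := size (rcons s x))).
    case: lX' => [[-> _ _ _ _] [_ ->] _ _]; rewrite size_rcons; lia.
  by eexists; first by []; apply: layout_cnt lX'.
set B := filter sel ns in lX5 *; set out1 := [:: Posz (size B)].
apply: (@wp_then _ _ 2 _ (fun st => exists2 X', st = (X', [::], out1) &
  layout n ns g n (size B) X')).
  have [[_ X5len _ _ X5zro] [_ X5cnt] _ _] := lX5.
  apply: wp_do; apply: (ends_in_print X5cnt); apply: (ends_in_add (v := n)).
    by rewrite X5len X5zro addr0.
  by eexists; first by []; apply: layout_ctr lX5.
move=> _ [X6 -> lX6].
pose print_after out (s : seq nat) := out ++ [seq Posz a | a <- s].
have printE out c (s : seq nat) (x k : nat) X' : layout n ns g k c X' -> X' elt = x ->
    ends_in [:: IPrint elt] (fun st =>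
      exists2 X2, st = (X2, [::], print_after out (rcons s x)) &
                  layout n ns g k c X2) (X', [::], print_after out s).
  move=> lX' X'elt; apply: (ends_in_print X'elt).
  by exists X' => //; rewrite /print_after map_rcons rcons_cat.
(* This presents the output as [print_after out1 [::]], the form in which the scan expects it. *)
rewrite -[out1]cats0.
apply: (wp_then (wp_scan (sel := sel) (cnt_of := fun=> size B)
  (out_of := print_after out1) sel_tmp _ _ lX6)) => // [s x k X'|_ [X7 -> lX7]].
  exact: printE.
set U := filter (predC sel) ns.
set out2 := print_after out1 _.
apply: (@wp_then _ _ 3 _ (fun st => exists2 X',
  st = (X', [::], rcons out2 (size U)) & layout n ns g n (size U) X')).
  have [[_ X7len _ _ X7zro] [_ X7cnt] _ _] := lX7.
  apply: wp_do; apply: (ends_in_sub (v := size U)).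
    by rewrite X7len X7cnt /n -(count_predC sel ns) !size_filter; lia.
  apply: ends_in_print; first by []; apply: (ends_in_add (v := n)).
    by rewrite /upd /= X7len X7zro addr0.
  by eexists; first by []; apply/layout_ctr/layout_cnt/lX7.
move=> _ [X8 -> lX8].
have sel_vlu (X' : nat -> int) x :
    X' vlu = g x -> X' tmp = (1 - g x)%R -> (0 < X' vlu)%R = ~~ (predC sel) x.
  by rewrite /= negbK => -> _.
rewrite -[rcons out2 _]cats0.
apply: wp_weaken (leqnn _) _ (wp_scan (sel := predC sel) (cnt_of := fun=> size U)
  (out_of := print_after (rcons out2 (size U))) sel_vlu _ _ lX8).
- by move=> _ [X9 -> _]; rewrite /out2 /print_after /= cat_rcons.
- by move=> s x k X'; apply: printE.
- by [].
Qed.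

Lemma run_cut_cmd ns ps (sel := fun a => (0 < balance ps a)%R) :
  run (compile cut_cmd 0) (40 * (size ns + size ps) + 30)
    (initial (encode_elements id ns ++ Posz (size ps) :: unpair ps))
  = Some (encode_elements id (filter sel ns)
            ++ encode_elements id (filter (predC sel) ns)).
Proof.
rewrite -[40 * _ + _]addn0.
have code : code_at (compile cut_cmd 0) 0 (compile cut_cmd 0).
  by move=> i _; rewrite add0n.
apply: (@wp_cut_cmd ns ps _ _ _ _ code) => -[[X inp] out] /= ->.
by [].
Qed.

(** * From lists of numbers to encoded posets and cuts *)

Section Link.
Context {d : Order.disp_t} {T : finPOrderType d} (name : T -> nat).
Hypothesis name_inj : injective name.
Variables (s : seq T) (r : seq (T * T)).
Hypothesis perm_r : perm_eq r (enum (lt_pairs [set: T] [set: T])).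
Local Notation ps := [seq (name q.1, name q.2) | q <- r].

Lemma count_enum (U : finType) (A : {set U}) (P : pred U) :
  count P (enum A) = #|[set x in A | P x]|.
Proof.
rewrite -size_filter cardE {1}/enum_mem -filter_predI /enum_mem.
by congr size; apply: eq_filter => x; rewrite !inE andbC.
Qed.

(** As [name] is injective, the pairs whose first name is [name x] are exactly those in [lt_pairs
    [set x] setT], and there are [above setT x] of them; dually for the second component. *)
Lemma balance_excess x : balance ps (name x) = excess setT x.
Proof.
rewrite /balance /excess !count_map; congr (_ - _)%R; congr Posz.
  rewrite (eq_count (a2 := fun q => q.1 == x)) => [|q /=]; last exact: inj_eq.
  rewrite (permP perm_r) count_enum -[RHS](big_set1 addn x (above setT)).
  rewrite -num_pairs_above; apply: eq_card => -[y z]; rewrite !inE /=.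
  by rewrite andbC.
rewrite (eq_count (a2 := fun q => q.2 == x)) => [|q /=]; last exact: inj_eq.
rewrite (permP perm_r) count_enum -[RHS](big_set1 addn x (below setT)).
rewrite -num_pairs_below; apply: eq_card => -[y z]; rewrite !inE /=.
by rewrite andbC.
Qed.

Lemma unpair_encode_pairs : Posz (size ps) :: unpair ps = encode_pairs name r.
Proof. by rewrite /encode_pairs /unpair size_map -map_comp. Qed.

Lemma encode_elements_map (l : seq T) :
  encode_elements id [seq name x | x <- l] = encode_elements name l.
Proof. by rewrite /encode_elements size_map -map_comp. Qed.

Lemma encodes_cut_filter (P : pred nat) (B : {set T}) :
  perm_eq s (enum T) -> (forall x, P (name x) = (x \in B)) ->
  encodes_cut name B (~: B)
    (encode_elements id [seq a <- [seq name x | x <- s] | P a] ++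
     encode_elements id [seq a <- [seq name x | x <- s] | predC P a]).
Proof.
move=> perm_s PB; exists [seq x <- s | x \in B], [seq x <- s | x \in (~: B)].
have perm_filter (A : {set T}) : perm_eq [seq x <- s | x \in A] (enum A).
  apply: uniq_perm => [||x].
  - by rewrite filter_uniq // (perm_uniq perm_s) enum_uniq.
  - exact: enum_uniq.
  - by rewrite mem_filter (perm_mem perm_s) !mem_enum andbT.
split=> //; rewrite !filter_map !encode_elements_map; congr (_ ++ _).
  by congr encode_elements; apply: eq_filter => x; rewrite /= PB.
by congr encode_elements; apply: eq_filter => x; rewrite /= PB inE.
Qed.
End Link.

Lemma run_cut_poset (d : Order.disp_t) (T : finPOrderType d) (name : T -> nat)
    (w : seq int) :
  injective name -> encodes_poset name w ->
  exists2 wout,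
    run (compile cut_cmd 0) (40 * poset_size T + 30) (initial w) = Some wout &
    encodes_cut name (@lower_half _ T) (~: lower_half) wout.
Proof.
move=> name_inj [s [r [perm_s perm_r ->]]].
have := run_cut_cmd [seq name x | x <- s] [seq (name q.1, name q.2) | q <- r].
rewrite unpair_encode_pairs encode_elements_map !size_map.
have -> : size s + size r = poset_size T.
  by rewrite (perm_size perm_s) (perm_size perm_r) -!cardE.
move=> ->; eexists; first by [].
apply: encodes_cut_filter => // x.
by rewrite (balance_excess name_inj perm_r) inE.
Qed.

(* Asymptotics of chains and of the running time, and the theorem *)
From mathcomp Require Import all_classical all_reals all_analysis.

Import numFieldNormedType.Exports.

Local Open Scope classical_set_scope.
Local Open Scope ring_scope.

Lemma affine_bigO (R : realType) (a b : nat) :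
  (fun n => (a * n + b)%:R : R^o) =O_\oo (fun n => n%:R : R^o).
Proof.
(* For [n >= 1] already [(a + b) * n] suffices; the successor makes the constant positive. *)
apply/eqO_exP; exists (a + b).+1%:R; first by [].
near=> n.
have n0 : (0 < n)%N by near: n; exact: nbhs_infty_gt.
by rewrite !normr_nat -natrM ler_nat; nia.
Unshelve. all: by end_near.
Qed.


(** With [4 * M <= n.+2 * n.+2] and [2 * e = n.+2 * n.+1] the ratio [2 * M / e] is at most
    [n.+2 / n.+1]; the lower bound comes from the balanced cut. At least two elements are taken so
    that [e] is nonzero. *)
Lemma chain_cut_ratio (R : realType) (n : nat) :
  (0 : R) <= 2 * (max_cut 'I_n.+2)%:R / (num_all_pairs 'I_n.+2)%:R - 1
    <= (n.+1%:R^-1 : R).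
Proof.
set M := max_cut _; set e := num_all_pairs _.
have eM : (e <= 2 * M)%N := num_all_pairs_max_cut _.
have Mn : (4 * M <= n.+2 * n.+2)%N by have := max_cut_card 'I_n.+2; rewrite card_ord.
have en : (2 * e = n.+2 * n.+1)%N := num_all_pairs_ord n.+2.
have e0 : 0 < e%:R :> R by rewrite ltr0n; lia.
rewrite subr_ge0 lerBlDr ler_pdivlMr // ler_pdivrMr // mul1r -natrM ler_nat eM /=.
have -> : n.+1%:R^-1 + 1 = n.+2%:R / n.+1%:R :> R.
  by rewrite -[n.+2]addn1 natrD mulrDl divff ?pnatr_eq0 // mul1r addrC.
by rewrite mulrAC ler_pdivlMr // -!natrM ler_nat; nia.
Qed.

Theorem theorem1p1 (R : realType) :
  (forall (d : Order.disp_t) (T : finPOrderType d),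
     exists B U : {set T},
       is_cut B U /\ (num_all_pairs T)%:R / 2 <= (num_pairs B U)%:R :> R)
  /\
  (exists (d : Order.disp_t) (P : nat -> finPOrderType d) (eps : nat -> R),
     [/\ (fun n => num_all_pairs (P n)) @ \oo --> \oo,
         eps @ \oo --> (0 : R)
       & forall n, (max_cut (P n))%:R =
                   (1 + eps n) / 2 * (num_all_pairs (P n))%:R :> R])
  /\
  (exists (p : program) (time : nat -> nat),
     (fun n => (time n)%:R : R^o) =O_\oo (fun n => n%:R : R^o) /\
     forall (d : Order.disp_t) (T : finPOrderType d) (name : T -> nat)
            (win : seq int),
       injective name -> encodes_poset name win ->
       exists (B U : {set T}) (wout : seq int),
         [/\ run p (time (poset_size T)) (initial win) = Some wout,
             encodes_cut name B U wout,
             is_cut B U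
           & (num_all_pairs T)%:R / 2 <= (num_pairs B U)%:R :> R]).
Proof.
have half (d : Order.disp_t) (T : finPOrderType d) (L := @lower_half d T) :
    (num_all_pairs T)%:R / 2 <= (num_pairs L (~: L)%SET)%:R :> R.
  rewrite ler_pdivrMr // -natrM ler_nat mulnC.
  exact: num_all_pairs_lower_half.
split; [|split].
- move=> d T; exists (@lower_half d T), (~: lower_half)%SET.
  by split; [exact: is_cut_setC | exact: half].
- exists _, (fun n => 'I_n.+2 : finPOrderType _).
  (* The required equation solved for [eps n], which is possible as these chains have a nonzero
     number of pairs. *)
  exists (fun n => 2 * (max_cut 'I_n.+2)%:R / (num_all_pairs 'I_n.+2)%:R - 1).
  split=> [||n].
  + apply/cvgnyPge => A; near=> n.
    have An : (A <= n)%N by near: n; exact: nbhs_infty_ge.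
    by have := num_all_pairs_ord n.+2; nia.
  + apply: squeeze_cvgr (cvg_cst 0) cvg_harmonic.
    by near=> n; exact: chain_cut_ratio.
  + have en := num_all_pairs_ord n.+2.
    have e0 : (num_all_pairs 'I_n.+2)%:R != 0 :> R by rewrite pnatr_eq0; lia.
    by field.
- exists (compile cut_cmd 0), (fun n => 40 * n + 30)%N; split.
    exact: affine_bigO.
  move=> d T name win name_inj /(run_cut_poset name_inj)[wout run_wout cut_wout].
  exists lower_half, (~: lower_half)%SET, wout.
  by split=> //; exact: is_cut_setC.
Unshelve. all: by end_near.
Qed.
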